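(* For any $m_1,m_2\in\mathbb{Z}$ with $m_1+1<m_2$, any $c\in\mathbb{R}$ and any $k\in\{0,1,\dots,\hat m_2\}$, where $\hat m_2:=m_2-m_1-1$, $$\underline{\mu}^c\left(\left\{\underline z: N^{\leftarrow p}_{m_2-1+\frac12}(\underline{z})-N^{\leftarrow p}_{m_1+\frac12}(\underline{z})=k\right\}\right)=\frac{q^{k(c+1-m_2)+\frac{k(k-1)}{2}}}{(-q^{c-m_2+1};q)_{\hat m_2}}\begin{bmatrix}\hat m_2\\ k\end{bmatrix}_q.$$
   Context: Fix $q\in(0,1)$. For $a\in\mathbb{R}$, $(a;q)_0=1$ and $(a;q)_n=\prod_{i=0}^{n-1}(1-aq^i)$ for $n\ge1$. The $q$-binomial coefficient is $\begin{bmatrix}n\\ m\end{bmatrix}_q=\frac{(q;q)_n}{(q;q)_m(q;q)_{n-m}}$ for $0\le m\le n$. For $c\in\mathbb{R}$, the blocking measure $\underline{\mu}^c$ of the asymmetric simple exclusion process (ASEP) is the product probability measure on $\{0,1\}^{\mathbb{Z}}$ under which the coordinates $z_i$ are independent with $\underline\mu^c(z_i=1)=\frac{q^{c-i}}{1+q^{c-i}}$. For $m\in\mathbb{Z}$, $N^{\leftarrow p}_{m+\frac12}(\underline z)=\sum_{i=-\infty}^m z_i$ (finite $\underline\mu^c$-a.s.), so the difference in the claim is the number of particles on the sites $m_1+1,\dots,m_2-1$. *)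

(* Defs.v *)
From mathcomp Require Import all_boot all_order all_algebra finmap.
From mathcomp Require Import all_classical all_reals all_analysis.

Set Implicit Arguments.
Unset Strict Implicit.
Unset Printing Implicit Defensive.

Import Order.TTheory GRing.Theory Num.Theory.
Local Open Scope classical_set_scope.
Local Open Scope ring_scope.

Section QNotation.
Context {R : realType}.

Definition qpoch (q a : R) (n : nat) : R := \prod_(i < n) (1 - a * q ^+ i).

(* Only meaningful for m <= n, since n - m is truncated. *)
Definition qbinom (q : R) (n m : nat) : R :=
  qpoch q q n / (qpoch q q m * qpoch q q (n - m)).

End QNotation.

Definition occupied (i : int) (z : int -> bool) : bool := z i.

Definition occupied_preimages : set_system (int -> bool) :=
  \bigcup_(i in [set: int]) preimage_set_system [set: int -> bool] (occupied i)
    (@measurable _ bool).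

(* {0,1}^Z with the product sigma-algebra: the smallest one making every
   coordinate measurable. *)
Definition configuration := g_sigma_algebraType occupied_preimages.

Definition mutually_independent (R : realType) (d d' : measure_display)
    (T : measurableType d) (T' : measurableType d') (P : probability T R)
    (I : choiceType) (X : I -> T -> T') : Prop :=
  forall (J : {fset I}) (B : I -> set T'),
    (forall i, i \in J -> measurable (B i)) ->
    (P (\bigcap_(i in [set` J]) X i @^-1` B i) =
     \prod_(i <- J) P (X i @^-1` B i))%E.

(* The product measure is pinned down by independence of the coordinates and
   its one-site marginals. *)
Definition is_blocking_measure (R : realType) (q c : R)
    (mu : probability configuration R) : Prop :=
  mutually_independent mu occupied /\
  forall i : int, mu [set z | occupied i z = true] =
    (q `^ (c - i%:~R) / (1 + q `^ (c - i%:~R)))%:E.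

(* Number of particles on the sites i <= m; it is +oo when there are infinitely
   many.  Since +oo - +oo = -oo in \bar R, a difference of two such counts is
   never a natural number on configurations with infinite counts. *)
Definition left_count (R : realType) (m : int) (z : int -> bool) : \bar R :=
  \esum_(i in [set i : int | i <= m]) ((z i)%:R%:E : \bar R).

(* Main.v *)
(* Read the window from right to left: site m2 - 1 - j is occupied with
   probability x q^j / (1 + x q^j), where x = q^(c - m2 + 1), independently in j,
   so the count satisfies a two-term recursion in the number of sites, which the
   q-Pascal rule solves.  The difference of the two left counts equals the
   window count wherever the left count at m1 is finite; this holds almost surely
   because its expectation is dominated by a geometric series. *)
Require Import Defs.
From mathcomp Require Import all_boot all_order all_algebra finmap.
From mathcomp Require Import all_classical all_reals all_analysis.
From mathcomp Require Import measurable_realfun zify ring.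
Set Implicit Arguments.
Unset Strict Implicit.
Unset Printing Implicit Defensive.
Import Order.TTheory GRing.Theory Num.Theory.
Local Open Scope classical_set_scope.
Local Open Scope ring_scope.

(** * The q-Pascal rule and the two-term recursion it solves *)

Section QBinomial.
Variables (R : realType) (q : R).
Hypotheses (hq0 : 0 < q) (hq1 : q < 1).

Lemma qpochS (a : R) n : qpoch q a n.+1 = qpoch q a n * (1 - a * q ^+ n).
Proof. by rewrite /qpoch big_ord_recr. Qed.

Lemma qpochq_neq0 n : qpoch q q n != 0.
Proof.
apply/prodf_neq0 => i _.
by rewrite -exprS subr_eq0 eq_sym lt_eqF// exprn_ilt1// ltW.
Qed.

Lemma qbinomn0 n : qbinom q n 0 = 1.
Proof.
by rewrite /qbinom subn0 [qpoch q q 0]/qpoch big_ord0 mul1r divff ?qpochq_neq0.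
Qed.

Lemma qbinomnn n : qbinom q n n = 1.
Proof.
by rewrite /qbinom subnn [qpoch q q 0]/qpoch big_ord0 mulr1 divff ?qpochq_neq0.
Qed.

(** Over a common denominator the two sides differ by the identity [1 - q^(n+1) = (1 - q^(n-k)) +
    q^(n-k) (1 - q^(k+1))]. The strict bound keeps the truncated [n - k.+1] a true difference; at
    [k = n] the formula would fail. *)
Lemma qbinom_pascal n k : (k < n)%N ->
  qbinom q n.+1 k.+1 = qbinom q n k.+1 + q ^+ (n - k) * qbinom q n k.
Proof.
move=> kn; rewrite /qbinom subSS.
have -> : (n - k = (n - k.+1).+1)%N by lia.
rewrite !qpochS -!exprS.
have hn : q ^+ n.+1 = q ^+ (n - k.+1).+1 * q ^+ k.+1.
  by rewrite -exprD; congr (_ ^+ _); lia.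
have h j : 1 - q ^+ j.+1 != 0.
  by rewrite subr_eq0 eq_sym lt_eqF// exprn_ilt1// ltW.
rewrite hn; move: (h k) (h (n - k.+1)%N) (qpochq_neq0 k) (qpochq_neq0 (n - k.+1)).
by move=> *; field; apply/and4P; split.
Qed.

End QBinomial.

(** Mass at [k] of a sum of [n] independent Bernoulli variables with parameters [p 0, ..., p (n-1)],
    computed by conditioning on the last variable. *)
Fixpoint poisson_binomial (R : realType) (p : nat -> R) (n k : nat) : R :=
  if n is m.+1 then
    poisson_binomial p m k * (1 - p m) +
    (if k is l.+1 then poisson_binomial p m l * p m else 0)
  else (k == 0%N)%:R.

(** The q-binomial theorem read coefficientwise: each new variable contributes a factor [1 + x q^n]
    to the denominator, and the numerators obey the q-Pascal rule. *)
Lemma poisson_binomial_geometric (R : realType) (q x : R) (n k : nat) :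
  0 < q -> q < 1 -> 0 < x ->
  poisson_binomial (fun j => x * q ^+ j / (1 + x * q ^+ j)) n k =
  if (k <= n)%N
  then x ^+ k * q ^+ 'C(k, 2) / qpoch q (- x) n * qbinom q n k else 0.
Proof.
move=> q0 q1 x0.
have pos j : 1 + x * q ^+ j != 0.
  by rewrite gt_eqF// addr_gt0// mulr_gt0// exprn_gt0.
have qpoch_neq0 m : qpoch q (- x) m != 0.
  by apply/prodf_neq0 => i _; rewrite mulNr opprK.
elim: n k => [|n IH] [|k] /=.
- by rewrite qbinomn0// /qpoch big_ord0 expr0 bin0n expr0 !mulr1 divr1.
- by [].
- rewrite IH leq0n !qbinomn0// qpochS expr0 bin0n expr0 mulNr opprK.
  by move: (pos n) (qpoch_neq0 n) => *; field; apply/andP.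
- rewrite !IH ltnS.
  have [kn|nk|->] := ltngtP k n.
  + rewrite qbinom_pascal// qpochS mulNr opprK binS bin1 exprD exprS.
    move: (pos n) (qpoch_neq0 n).
    (* The factor [q^k] raises [q^'C(k, 2)] to [q^'C(k.+1, 2)]; the remaining [q^(n-k)] is the
       weight in the q-Pascal rule. *)
    have -> : q ^+ n = q ^+ (n - k) * q ^+ k by rewrite -exprD subnK// ltnW.
    by move=> *; field; apply/andP.
  + by rewrite !mul0r addr0.
  (* On the diagonal only the term in which the last variable equals 1 survives. *)
  + rewrite !qbinomnn// qpochS mulNr opprK binS bin1 exprD exprS mul0r add0r.
    by move: (pos n) (qpoch_neq0 n) => *; field; apply/andP.
Qed.

(** * Independence and the law of a finite count *)

Lemma mutually_independent_inj (R : realType) (d d' : measure_display)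
    (T : measurableType d) (T' : measurableType d') (P : probability T R)
    (I K : choiceType) (X : I -> T -> T') (e : K -> I) :
  injective e -> mutually_independent P X ->
  mutually_independent P (fun j => X (e j)).
Proof.
move=> einj indep J B mB.
(* The constraints are carried along [e] to the larger index type; injectivity ensures that [e j]
   receives the constraint of [j] alone. *)
pose B' i : set T' := [set y | exists2 j, i = e j & B j y].
have B'e j : B' (e j) = B j.
  by apply/seteqP; split=> [y [j' /einj ->]|y By] //; exists j.
have -> : \bigcap_(j in [set` J]) X (e j) @^-1` B j =
          \bigcap_(i in [set` [fset e j | j in J]%fset]) X i @^-1` B' i.
  apply/seteqP; split=> t Ht.
    by move=> i /= /imfsetP[j /= jJ ->]; rewrite /= B'e; exact: Ht.
  move=> j /= jJ; have := Ht (e j); rewrite /= B'e; apply.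
  by apply/imfsetP; exists j.
rewrite indep => [|i /imfsetP[j /= jJ ->]]; last by rewrite B'e; exact: mB.
rewrite big_imfset /=; last by move=> j j' _ _ /einj.
by apply: eq_bigr => j _; rewrite B'e.
Qed.

Lemma measurable_bool_fiber (d : measure_display) (T : measurableType d)
    (f : T -> bool) (b : bool) :
  measurable_fun [set: T] f -> measurable [set t | f t = b].
Proof. by move=> mf; rewrite -[X in measurable X]setTI; exact: (mf _ [set b]). Qed.

Section CountLaw.
Variables (R : realType) (d : measure_display) (T : measurableType d).
Variables (P : probability T R) (X : nat -> T -> bool) (p : nat -> R).
Hypothesis mX : forall j, measurable_fun setT (X j).
Hypothesis indepX : mutually_independent P X.
Hypothesis PX : forall j, P [set t | X j t = true] = (p j)%:E.

Let cylinder (n N : nat) (b : nat -> bool) : set T :=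
  [set t | forall j, (n <= j < N)%N -> X j t = b j].

Let count (n : nat) (t : T) : nat := (\sum_(j < n) X j t)%N.

Let measurable_coordinate j b : measurable [set t | X j t = b].
Proof. exact/measurable_bool_fiber/mX. Qed.

Lemma measurable_count n k : measurable [set t | count n t = k].
Proof.
elim: n k => [|n IH] k.
  rewrite (_ : [set t | _] = if k == 0%N then setT else set0).
    by case: ifP => _; [exact: measurableT|exact: measurable0].
  apply/seteqP; split=> t; rewrite /count /= big_ord0; first by move=> <-.
  by case: eqP.
rewrite (_ : [set t | _] =
    ([set t | count n t = k] `&` [set t | X n t = false]) `|`
    ([set t | (count n t).+1 = k] `&` [set t | X n t = true])).
  apply: measurableU; apply: measurableI => //; try exact: measurable_coordinate.
  case: k => [|k]; last first.
    rewrite (_ : [set t | _] = [set t | count n t = k])//.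
    by apply/seteqP; split=> t /=; [move=> []|move=> ->].
  by rewrite (_ : [set t | _] = set0)//; apply/seteqP; split.
apply/seteqP; split=> t; rewrite /count /= big_ord_recr /=.
  by case: (X n t); rewrite ?addn0 ?addn1; [right|left].
by move=> [[<- ->]|[<- ->]]; rewrite ?addn0 ?addn1.
Qed.

Lemma measurable_cylinder n N b : measurable (cylinder n N b).
Proof.
rewrite (_ : cylinder n N b =
    \bigcap_(j in [set j | (n <= j < N)%N]) [set t | X j t = b j])//.
by apply: bigcap_measurableType => // j _; exact: measurable_coordinate.
Qed.

Let weight j (b : bool) : R := if b then p j else 1 - p j.

Lemma probability_coordinate j b : P [set t | X j t = b] = (weight j b)%:E.
Proof.
case: b => //=.
rewrite (_ : [set t | _] = ~` [set t | X j t = true]).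
  by rewrite probability_setC ?PX//; exact: measurable_coordinate.
by apply/seteqP; split=> t /=; case: (X j t).
Qed.

Lemma probability_cylinder n N b :
  P (cylinder n N b) = (\prod_(n <= j < N) weight j (b j))%:E.
Proof.
rewrite (_ : cylinder n N b =
  \bigcap_(j in [set` [fset j in index_iota n N]%fset]) X j @^-1` [set b j]).
  rewrite indepX// (perm_big (index_iota n N)) /=; last first.
    by apply: uniq_perm; rewrite ?fset_uniq ?iota_uniq// => j; rewrite in_fset.
  rewrite -prodEFin; apply: eq_bigr => j _; exact: probability_coordinate.
apply/seteqP; split=> t Ht j.
  by rewrite /= in_fset/= mem_index_iota => /Ht.
by move=> nj; apply: Ht; rewrite /= in_fset/= mem_index_iota.
Qed.

(* Keeping the later coordinates in a cylinder turns each induction step into a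
   split on the value of coordinate n. *)
Lemma probability_count_cylinder n N k b : (n <= N)%N ->
  P ([set t | count n t = k] `&` cylinder n N b) =
  (poisson_binomial p n k * \prod_(n <= j < N) weight j (b j))%:E.
Proof.
elim: n k b => [|n IH] k b nN.
  rewrite /=; case: k => [|k] /=.
    rewrite mul1r -probability_cylinder; congr (P _).
    by apply/seteqP; split=> [t []//|t Ht]; split=> //; rewrite /count /= big_ord0.
  rewrite mul0r (_ : _ `&` _ = set0) ?measure0//.
  by apply/seteqP; split=> t //= []; rewrite /count big_ord0.
(* [upd c] prescribes the value [c] at coordinate [n] on top of the pattern [b]. The induction
   hypothesis is applied to these patterns, which is why [b] is generalised. *)
pose upd (c : bool) j := if j == n then c else b j.
have cylE c t : cylinder n N (upd c) t <-> X n t = c /\ cylinder n.+1 N b t.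
  split=> [Ht|[Xn Ht] j /andP[nj jN]].
    split; first by rewrite Ht ?leqnn// /upd eqxx.
    move=> j /andP[nj jN]; rewrite Ht ?(ltnW nj)// /upd gtn_eqF//.
  rewrite /upd; case: eqVneq => [->//|jn]; apply: Ht.
  by rewrite jN ltn_neqAle eq_sym jn nj.
have weightE c : \prod_(n <= j < N) weight j (upd c j) =
    weight n c * \prod_(n.+1 <= j < N) weight j (b j).
  rewrite big_ltn// /upd eqxx; congr (_ * _).
  by apply: eq_big_nat => j /andP[nj _]; rewrite gtn_eqF.
have countS t : count n.+1 t = (count n t + X n t)%N.
  by rewrite /count big_ord_recr.
have splitE : [set t | count n.+1 t = k] `&` cylinder n.+1 N b =
    ([set t | count n t = k] `&` cylinder n N (upd false)) `|`
    ([set t | (count n t).+1 = k] `&` cylinder n N (upd true)).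
  apply/seteqP; split=> t.
    move=> [/=]; rewrite countS; case Xn : (X n t) => <- Ht;
      [right|left]; split; rewrite /= ?addn0 ?addn1//; exact/cylE.
  by move=> [[/= <- /cylE[Xn Ht]]|[/= <- /cylE[Xn Ht]]]; split=> //=;
    rewrite countS Xn ?addn0 ?addn1.
have mS l : measurable [set t | (count n t).+1 = l].
  case: l => [|l].
    by rewrite (_ : [set t | _] = set0)//; apply/seteqP; split.
  rewrite (_ : [set t | _] = [set t | count n t = l]); first exact: measurable_count.
  by apply/seteqP; split=> t /=; [move=> []|move=> ->].
rewrite splitE measureU; first last.
- apply/seteqP; split=> t //= [[_ /cylE[Xn _]] [_ /cylE[]]].
  by rewrite Xn.
- by apply: measurableI; [exact: mS|exact: measurable_cylinder].
- by apply: measurableI; [exact: measurable_count|exact: measurable_cylinder].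
rewrite /= IH ?(ltnW nN)// weightE.
case: k {splitE} => [|k] /=.
  rewrite (_ : _ `&` _ = set0) ?measure0; last by apply/seteqP; split=> t [].
  by rewrite adde0 addr0 mulrA.
rewrite (_ : [set t | _] = [set t | count n t = k]); last first.
  by apply/seteqP; split=> t /=; [move=> []|move=> ->].
by rewrite IH ?(ltnW nN)// weightE -EFinD !mulrA -mulrDl.
Qed.

Lemma probability_count n k :
  P [set t | (\sum_(j < n) X j t)%N = k] = (poisson_binomial p n k)%:E.
Proof.
(* With [N = n] the cylinder constrains nothing and its weight is the empty product. *)
have := probability_count_cylinder k (fun=> true) (leqnn n).
rewrite big_geq// mulr1 => <-; congr (P _).
by apply/seteqP; split=> [t Ht|t []//]; split=> // j; lia.
Qed.

End CountLaw.

(** * Left counts as measurable series *)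

Lemma gt0_powRD (R : realType) (a r s : R) :
  0 < a -> a `^ (r + s) = a `^ r * a `^ s.
Proof. by move=> a0; rewrite powRD// (gt_eqF a0) implybT. Qed.

Lemma measurable_occupied i : measurable_fun [set: configuration] (occupied i).
Proof.
move=> _ Y mY; apply: sub_sigma_algebra.
by exists i => //; exists Y.
Qed.

Lemma measurable_occupation (R : realType) (i : int) :
  measurable_fun [set: configuration]
    (fun z : configuration => (z i)%:R%:E : \bar R).
Proof.
apply/measurable_EFinP.
have mR : measurable_fun [set: bool] (fun b : bool => b%:R : R) by [].
exact: measurableT_comp mR (measurable_occupied i).
Qed.

(** Enumerating the half-line as [m, m-1, ...] turns the unordered sum into a series, which can be
    split, measured and integrated term by term. *)
Lemma left_countE (R : realType) (m : int) (z : int -> bool) :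
  left_count R m z = (\sum_(j <oo) (z (m - j%:Z))%:R%:E)%E.
Proof.
rewrite nneseries_esumT; last by move=> j; rewrite lee_fin ler0n.
rewrite /left_count.
rewrite (@reindex_esum _ _ _ setT _ (fun j : nat => m - j%:Z))//.
split.
- by move=> j _ /=; lia.
- by move=> j j' _ _; lia.
- by move=> i /= im; exists `|m - i|%N => //; lia.
Qed.

(** Stated as an addition, the splitting of nonnegative terms holds even when the counts are
    infinite; finiteness matters only for subtraction. *)
Lemma left_count_addn (R : realType) (m : int) (n : nat) (z : int -> bool) :
  left_count R m z =
  ((\sum_(j < n) z (m - j%:Z)%R)%N%:R%:E + left_count R (m - n%:Z) z)%E.
Proof.
rewrite !left_countE (nneseries_split 0 n); last first.
  by move=> j _; rewrite lee_fin ler0n.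
rewrite add0n big_mkord natr_sum -sumEFin; congr (_ + _)%E.
rewrite -nneseries_addn; last by move=> j; rewrite lee_fin ler0n.
apply: eq_eseriesr => j _.
by rewrite (_ : m - n%:Z - j%:Z = m - (j + n)%N%:Z)//; lia.
Qed.

Lemma measurable_left_count (R : realType) (m : int) :
  measurable_fun [set: configuration]
    (fun z : configuration => left_count R m z : \bar R).
Proof.
apply: (eq_measurable_fun (fun z : configuration =>
    (\sum_(j <oo) (z (m - j%:Z))%:R%:E)%E)) => [z _|]; first by rewrite left_countE.
apply: ge0_emeasurable_sum => [j z _ _|j _]; first by rewrite lee_fin ler0n.
exact: measurable_occupation.
Qed.

(** * Almost sure finiteness and window counts under the blocking measure *)

Section BlockingMeasure.
Variables (R : realType) (q c : R) (mu : probability configuration R).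
Hypotheses (hq0 : 0 < q) (hmu : is_blocking_measure q c mu).

(** The odds of occupation form a geometric progression to the left of [m], which gives the
    marginals the shape required by [poisson_binomial_geometric]. *)
Lemma powR_site (m : int) (j : nat) :
  q `^ (c - (m - j%:Z)%:~R) = q `^ (c - m%:~R) * q ^+ j.
Proof.
rewrite -powR_mulrn ?ltW// -gt0_powRD//.
by congr (_ `^ _); rewrite intrB; ring.
Qed.

Lemma left_count_finite_ae (m : int) :
  q < 1 -> {ae mu, forall z, left_count R m z \is a fin_num}.
Proof.
move=> hq1.
have int_lt : (\int[mu]_z left_count R m z < +oo)%E.
  rewrite (eq_integral (fun z : configuration =>
      (\sum_(j <oo) (z (m - j%:Z))%:R%:E)%E)); last first.
    by move=> z _; rewrite left_countE.
  rewrite integral_nneseries//; last first.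
    by move=> j; exact: measurable_occupation.
  apply: (@le_lt_trans _ _ (\sum_(j <oo) (q `^ (c - m%:~R) * q ^+ j)%:E)%E).
    apply: lee_nneseries => [j _ _|j _].
      by apply: integral_ge0 => z _; rewrite lee_fin ler0n.
    rewrite (_ : (\int[mu]_z _)%E =
      (\int[mu]_z (\1_[set z | occupied (m - j%:Z) z = true] z)%:E)%E); last first.
      apply: eq_integral => z _; rewrite indicE /occupied.
      by congr ((nat_of_bool _)%:R%:E); apply/idP/idP; rewrite inE.
    rewrite integral_indic//; last first.
      by apply: measurable_bool_fiber; exact: measurable_occupied.
    rewrite setIT /= hmu.2 powR_site lee_fin.
    have a_ge0 : 0 <= q `^ (c - m%:~R) * q ^+ j.
      by rewrite mulr_ge0 ?powR_ge0 ?exprn_ge0 ?ltW.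
    (* The marginal [a / (1 + a)] is at most the odds [a], a term of a summable geometric series. *)
    by rewrite ler_pdivrMr ?ltr_wpDr// mulrDr mulr1 lerDl mulr_ge0.
  apply: (@le_lt_trans _ _ (q `^ (c - m%:~R) * (1 - q)^-1)%:E); last exact: ltry.
  apply: lime_le.
    apply: is_cvg_nneseries => j _ _.
    by rewrite lee_fin mulr_ge0 ?powR_ge0 ?exprn_ge0 ?ltW.
  apply: nearW => n; rewrite sumEFin lee_fin.
  by apply: geometric_le_lim; rewrite ?powR_ge0// ger0_norm ?ltW.
have count_ge0 z : (0 <= left_count R m z)%E.
  by apply: esum_ge0 => i _; rewrite lee_fin ler0n.
have count_int : mu.-integrable setT (fun z : configuration => left_count R m z : \bar R).
  apply/integrableP; split; first exact: measurable_left_count.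
  rewrite (eq_integral (fun z : configuration => left_count R m z))//.
  by move=> z _; rewrite gee0_abs.
(* A nonnegative function of finite expectation is finite outside a null set. *)
have [N [mN N0 subN]] := integrable_ae measurableT count_int.
exists N; split=> // z /= nfin; apply: subN => /= fin.
exact/nfin/fin.
Qed.

Lemma blocking_window_count (m : int) (n k : nat) :
  mu [set z : configuration | (\sum_(j < n) z (m - j%:Z)%R)%N = k] =
  (poisson_binomial (fun j => q `^ (c - m%:~R) * q ^+ j /
     (1 + q `^ (c - m%:~R) * q ^+ j)) n k)%:E.
Proof.
apply: (@probability_count R _ _ mu (fun j => occupied (m - j%:Z))).
- by move=> j; exact: measurable_occupied.
- apply: (mutually_independent_inj (e := fun j : nat => m - j%:Z) _ hmu.1).
  by move=> j j'; lia.
- by move=> j; rewrite hmu.2 powR_site.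
Qed.

End BlockingMeasure.

(** * The law of the difference of left counts *)

Theorem lemma1p3 (R : realType) (q : R) (hq0 : 0 < q) (hq1 : q < 1)
    (m1 m2 : int) (hm : m1 + 1 < m2) (c : R)
    (mu : probability configuration R) (hmu : is_blocking_measure q c mu)
    (k : nat) (hk : k%:Z <= m2 - m1 - 1) :
  let mhat := `|(m2 - m1 - 1)%R|%N in
  mu [set z : configuration |
       (left_count R (m2 - 1) z - left_count R m1 z)%E = (k%:R)%:E] =
  (q `^ (k%:R * (c + 1 - m2%:~R) + k%:R * (k%:R - 1) / 2)
     / qpoch q (- q `^ (c - m2%:~R + 1)) mhat * qbinom q mhat k)%:E.
Proof.
move=> mhat.
(* The window [m1 + 1, ..., m2 - 1] has [mhat] sites; the absolute value in [mhat] changes nothing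
   since [m1 + 1 < m2]. *)
have m1E : m1 = m2 - 1 - mhat%:Z by rewrite /mhat; lia.
have kmhat : (k <= mhat)%N by rewrite /mhat; lia.
set x := q `^ (c - m2%:~R + 1).
have xE : q `^ (c - (m2 - 1)%:~R) = x.
  by congr (_ `^ _); rewrite intrB; ring.
have -> : q `^ (k%:R * (c + 1 - m2%:~R) + k%:R * (k%:R - 1) / 2) =
    x ^+ k * q ^+ 'C(k, 2).
  rewrite -!powR_mulrn ?powR_ge0 ?ltW// -powRrM -gt0_powRD//.
  rewrite [c + 1 - _]addrAC [k%:R * (_ + 1)]mulrC.
  (* The real exponent [k(k-1)/2] is the natural number ['C(k, 2)], so the real power becomes an
     ordinary one. *)
  suff -> : k%:R * (k%:R - 1) = 'C(k, 2)%:R * 2 :> R by rewrite mulfK// pnatr_eq0.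
  case: k {hk kmhat} => [|k]; first by rewrite bin0n !mul0r.
  by rewrite -natrM mulnC -mul_bin_diag bin1 natrM -natr1 addrK.
have := poisson_binomial_geometric mhat k hq0 hq1 (powR_gt0 (c - m2%:~R + 1) hq0).
rewrite kmhat -/x => <-; rewrite -xE -(blocking_window_count hq0 hmu).
(* Cancelling the common tail is legitimate only where it is finite. *)
have diffE z : left_count R m1 z \is a fin_num ->
    (left_count R (m2 - 1) z - left_count R m1 z)%E =
    (\sum_(j < mhat) z (m2 - 1 - j%:Z)%R)%N%:R%:E.
  by move=> fin; rewrite (left_count_addn _ (m2 - 1) mhat) -m1E addeK.
have [N [mN muN0 subN]] := left_count_finite_ae hq0 hmu m1 hq1.
have finN z : ~ N z -> left_count R m1 z \is a fin_num.
  by move=> Nz; apply: contrapT => nfin; apply: Nz; exact: subN.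
have mcount : measurable [set z : configuration |
    (\sum_(j < mhat) z (m2 - 1 - j%:Z)%R)%N = k].
  apply: (@measurable_count _ configuration
    (fun j (z : configuration) => occupied (m2 - 1 - j%:Z) z)) => j.
  exact: measurable_occupied.
have mdiff : measurable [set z : configuration |
    (left_count R (m2 - 1) z - left_count R m1 z)%E = (k%:R)%:E].
  rewrite -[X in measurable X]setTI.
  exact: (emeasurable_funB (measurable_left_count (m2 - 1))
    (measurable_left_count m1) measurableT (emeasurable_set1 k%:R%:E)).
(* The two events agree off the null set [N]; adjoining [N] to both makes them equal as sets and
   preserves their measures. *)
rewrite -(measureU0 mdiff mN muN0) -(measureU0 mcount mN muN0); congr (mu _).
apply/seteqP; split=> z [/= Hz|Nz]; try (by right);
  case: (pselect (N z)) => Nz; try (by right); left; move: Hz => /=.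
- by rewrite diffE ?finN// => -[/eqP]; rewrite eqr_nat => /eqP.
- by rewrite diffE ?finN// => ->.
Qed.
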